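(* Let $\mathfrak C$ be a left cancellative small category. The canonical projection $I_l\ltimes\Omega\twoheadrightarrow I_l\,\bar\ltimes\,\Omega$ is an isomorphism (of topological groupoids) if one of the following holds: (i) $\mathfrak C$ is finitely aligned. (ii) $I_l\ltimes\Omega$ is Hausdorff.
   Context: $\mathfrak C$ denotes the set of morphisms, $\mathfrak C^0\subseteq\mathfrak C$ the identity morphisms, $\mathfrak d,\mathfrak t$ domain and target; $cd$ is defined iff $\mathfrak d(c)=\mathfrak t(d)$; left cancellative means $cx=cy\Rightarrow x=y$. $\mathfrak C$ is finitely aligned if for all $a,b\in\mathfrak C$ there is a finite $F\subseteq\mathfrak C$ with $a\mathfrak C\cap b\mathfrak C=\bigcup_{c\in F}c\mathfrak C$. Each $c\in\mathfrak C$ gives the partial bijection $\mathfrak d(c)\mathfrak C\to c\mathfrak C$, $x\mapsto cx$; $I_l$ is the smallest semigroup of partial bijections of $\mathfrak C$ containing these and closed under inverses; $\mathcal J=\{\mathrm{dom}(s):s\in I_l\}$ is its semilattice of idempotents (product = intersection). $\bar{\mathcal J}$ is the set of subsets $\varepsilon=e\setminus\bigcup_{i=1}^nf_i$ with $e,f_i\in\mathcal J$, $f_i\subseteq e$. $\widehat{\mathcal J}$ is the space of non-zero multiplicative maps $\chi:\mathcal J\to\{0,1\}$ with $\chi(\emptyset)=0$ if $\emptyset\in\mathcal J$ (pointwise convergence). $\Omega\subseteq\widehat{\mathcal J}$ consists of those $\chi$ such that whenever $e=\bigcup_{i=1}^nf_i$ ($e,f_i\in\mathcal J$) and $\chi(e)=1$,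 then $\chi(f_i)=1$ for some $i$. For $\chi\in\Omega$, $\varepsilon=e\setminus\bigcup f_i\in\bar{\mathcal J}$, put $\chi(\varepsilon)=1$ iff $\chi(e)=1$ and all $\chi(f_i)=0$, and $\chi(\varepsilon)=0$ otherwise. $s\in I_l$ acts by $\chi\mapsto s.\chi=\chi(s^{-1}\cdot s)$ from $\Omega(s^{-1}s)=\{\chi\in\Omega:\chi(s^{-1}s)=1\}$ onto $\Omega(ss^{-1})$. $I_l\ltimes\Omega$ is the quotient of $\{(s,\chi)\in I_l\times\Omega:\chi(s^{-1}s)=1\}$ by $(s,\chi)\sim(t,\psi)$ iff $\chi=\psi$ and $se=te$ for some $e\in\mathcal J$ with $\chi(e)=1$; $I_l\,\bar\ltimes\,\Omega$ is the quotient by $(s,\chi)\bar\sim(t,\psi)$ iff $\chi=\psi$ and $s\varepsilon=t\varepsilon$ for some $\varepsilon\in\bar{\mathcal J}$ with $\chi(\varepsilon)=1$ ($se$, $s\varepsilon$ denote restrictions as partial bijections). Both are groupoids with source $\chi$, range $s.\chi$, $[s,t.\chi][t,\chi]=[st,\chi]$; in both cases the topology is such that the images of $\{s\}\times\Omega(s^{-1}s)$ are open and mapped homeomorphically onto $\Omega(s^{-1}s)$ by the source map. The canonical projection sends the $\sim$-class of $(s,\chi)$ to its $\bar\sim$-class. *)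

(* Defs.v *)
From HB Require Import structures.
From mathcomp Require Import all_boot all_classical topology.

Set Implicit Arguments.
Unset Strict Implicit.
Unset Printing Implicit Defensive.

Local Open Scope classical_set_scope.
Local Open Scope quotient_scope.

(** * Topological groupoids *)

(* A groupoid with arrow space [garr] and unit space [gobj]; [gmul g h] is
   only meaningful when [gsrc g = grng h]. *)
Record topGroupoid := TopGroupoid {
  garr :> topologicalType;
  gobj : topologicalType;
  gsrc : garr -> gobj;
  grng : garr -> gobj;
  gone : gobj -> garr;
  gmul : garr -> garr -> garr;
  ginv : garr -> garr;
  gsrc_one : forall x, gsrc (gone x) = x;
  grng_one : forall x, grng (gone x) = x;
  gsrc_mul : forall g h, gsrc g = grng h -> gsrc (gmul g h) = gsrc h;
  grng_mul : forall g h, gsrc g = grng h -> grng (gmul g h) = grng g;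
  gmulA : forall g h k, gsrc g = grng h -> gsrc h = grng k ->
    gmul g (gmul h k) = gmul (gmul g h) k;
  gmul1g : forall g, gmul (gone (grng g)) g = g;
  gmulg1 : forall g, gmul g (gone (gsrc g)) = g;
  gsrc_inv : forall g, gsrc (ginv g) = grng g;
  grng_inv : forall g, grng (ginv g) = gsrc g;
  gmulVg : forall g, gmul (ginv g) g = gone (gsrc g);
  gmulgV : forall g, gmul g (ginv g) = gone (grng g);
  gsrc_continuous : continuous gsrc;
  grng_continuous : continuous grng;
  gone_continuous : continuous gone;
  ginv_continuous : continuous ginv;
  gmul_continuous : {within [set p : garr * garr | gsrc p.1 = grng p.2],
    continuous (fun p => gmul p.1 p.2)}
}.

Definition groupoid_morphism (G H : topGroupoid) (F : G -> H) : Prop :=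
  forall g h : G, gsrc g = grng h ->
    gsrc (F g) = grng (F h) /\ F (gmul g h) = gmul (F g) (F h).

Definition topGroupoid_isomorphism (G H : topGroupoid) (F : G -> H) : Prop :=
  groupoid_morphism F /\ continuous F /\
  exists F' : H -> G, [/\ cancel F F', cancel F' F,
    groupoid_morphism F' & continuous F'].

Lemma open_xsection_at (X Y : topologicalType) (x : X) (B : set (X * Y)) :
  open B -> open [set y | B (x, y)].
Proof.
rewrite !openE => oB y /= /oB [[P Q] /= [Px Qy] PQB].
by apply: filterS Qy => z Qz; apply: PQB; split => //=; exact: nbhs_singleton.
Qed.

Lemma open_setX (X Y : topologicalType) (A : set X) (B : set Y) :
  open A -> open B -> open (A `*` B).
Proof.
move=> oA oB; rewrite openE => -[x y] [/= Ax By].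
by exists (A, B) => //; split; apply: open_nbhs_nbhs.
Qed.

(** * Left cancellative small categories *)

(* A small category is given by its set of morphisms; objects are identified
   with identity morphisms, i.e. with the fixed points of [src] (equivalently,
   of [tgt]).  [comp c d] is the composite "first d, then c"; composition is
   partial, so the value of [comp c d] is irrelevant unless [src c = tgt d]. *)
Record smallCategory := SmallCategory {
  mor :> Type;
  src : mor -> mor;
  tgt : mor -> mor;
  comp : mor -> mor -> mor;
  src_src : forall c, src (src c) = src c;
  tgt_src : forall c, tgt (src c) = src c;
  src_tgt : forall c, src (tgt c) = tgt c;
  tgt_tgt : forall c, tgt (tgt c) = tgt c;
  src_comp : forall c d, src c = tgt d -> src (comp c d) = src d;
  tgt_comp : forall c d, src c = tgt d -> tgt (comp c d) = tgt c;
  comp_src : forall c, comp c (src c) = c;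
  comp_tgt : forall c, comp (tgt c) c = c;
  compA : forall b c d, src b = tgt c -> src c = tgt d ->
    comp b (comp c d) = comp (comp b c) d
}.

Definition left_cancellative (C : smallCategory) : Prop :=
  forall c x y : C, src c = tgt x -> src c = tgt y ->
    comp c x = comp c y -> x = y.

Record lcCategory := LCCategory {
  lc_cat :> smallCategory;
  lc_cancel : left_cancellative lc_cat
}.

Definition right_ideal (C : smallCategory) (c : C) : set C :=
  [set comp c x | x in [set x | src c = tgt x]].

Definition finitely_aligned (C : smallCategory) : Prop :=
  forall a b : C, exists2 F : set C, finite_set F &
    right_ideal a `&` right_ideal b = \bigcup_(c in F) right_ideal c.

(** * Partial bijections *)

(* A partial map s is represented by its graph, the set of all (x, s x). *)
Section PartialBijections.
Variable T : Type.
Implicit Types (r s t : set (T * T)) (A B : set T).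

Definition is_pbij r : Prop :=
  (forall x y z, r (x, y) -> r (x, z) -> y = z) /\
  (forall x y z, r (x, z) -> r (y, z) -> x = y).

Definition pdom r : set T := [set x | exists y, r (x, y)].

Definition pinv r : set (T * T) := [set p | r (p.2, p.1)].

Definition pmul s t : set (T * T) :=
  [set p | exists2 y, t (p.1, y) & s (y, p.2)].

Definition prestr r A : set (T * T) := [set p | r p /\ A p.1].

Definition ppreim r A : set T := [set x | exists2 y, r (x, y) & A y].

Lemma pdom_mul s t : pdom (pmul s t) = ppreim t (pdom s).
Proof.
apply/seteqP; split=> x /=.
- by case=> z [y txy syz]; exists y => //; exists z.
- by case=> y txy [z syz]; exists z; exists y.
Qed.

Lemma pinvK r : pinv (pinv r) = r.
Proof. by apply/seteqP; split=> -[]. Qed.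

Lemma ppreim_inv_dom r : is_pbij r -> ppreim r (pdom (pinv r)) = pdom r.
Proof.
move=> _; apply/seteqP; split=> x /=; first by case=> y rxy _; exists y.
by case=> y rxy; exists y => //; exists x.
Qed.

Lemma ppreimI r A B : is_pbij r ->
  ppreim r (A `&` B) = ppreim r A `&` ppreim r B.
Proof.
move=> [fr _]; apply/seteqP; split=> x /=.
- by case=> y rxy [Ay By]; split; exists y.
- case=> [[y rxy Ay] [z rxz Bz]]; exists y => //; split => //.
  by rewrite (fr _ _ _ rxy rxz).
Qed.

Lemma ppreim_bigcup (I : Type) r (F : I -> set T) :
  ppreim r (\bigcup_i F i) = \bigcup_i ppreim r (F i).
Proof.
apply/seteqP; split=> x /=.
- by case=> y rxy [i _ Fiy]; exists i => //; exists y.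
- by case=> i _ [y rxy Fiy]; exists y => //; exists i.
Qed.

Lemma ppreim0 r : ppreim r set0 = set0.
Proof. by apply/seteqP; split=> x //= []. Qed.

Lemma ppreimD r A B : is_pbij r ->
  ppreim r (A `\` B) = ppreim r A `\` ppreim r B.
Proof.
move=> [fr _]; apply/seteqP; split=> x /=.
- case=> y rxy [Ay By]; split; first by exists y.
  by case=> z rxz Bz; apply: By; rewrite (fr _ _ _ rxy rxz).
- case=> [[y rxy Ay] nB]; exists y => //; split => // By.
  by apply: nB; exists y.
Qed.

Lemma ppreim_mul s t A : ppreim (pmul s t) A = ppreim t (ppreim s A).
Proof.
apply/seteqP; split=> x /=.
- by case=> z [y txy syz] Az; exists y => //; exists z.
- by case=> y txy [z syz Az]; exists z => //; exists y.
Qed.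

Lemma ppreimV r A : is_pbij r ->
  ppreim r (ppreim (pinv r) A) = pdom r `&` A.
Proof.
move=> [_ ir]; apply/seteqP; split=> x /=.
- case=> y rxy [z rzy Az]; split; first by exists y.
  by rewrite (ir _ _ _ rxy rzy).
- by case=> [[y rxy] Ax]; exists y => //; exists x.
Qed.

Lemma ppreim_idem r A : is_pbij r ->
  ppreim (pmul (pinv r) r) A = pdom r `&` A.
Proof. by move=> rb; rewrite ppreim_mul ppreimV. Qed.

Lemma pdom_idem r : is_pbij r -> pdom (pmul (pinv r) r) = pdom r.
Proof. by move=> rb; rewrite pdom_mul ppreim_inv_dom. Qed.

Lemma pmul_idemE r : is_pbij r ->
  pmul (pinv r) r = [set p | p.1 = p.2 /\ pdom r p.1].
Proof.
move=> [_ ir]; apply/seteqP; split=> -[x y] /=.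
- by case=> z rxz ryz; split; [exact: ir rxz ryz | exists z].
- by case=> <- [z rxz]; exists z.
Qed.

Lemma prestrE r A B : prestr (prestr r A) B = prestr r (A `&` B).
Proof. by apply/seteqP; split=> -[x y] /= => [[[]]|[? []]]. Qed.

Lemma prestr_ppreim s t A B : prestr s A = prestr t A ->
  ppreim s B `&` A = ppreim t B `&` A.
Proof.
move=> st; apply/seteqP; split=> x /=.
- case=> [[y sxy By] Ax]; split => //; exists y => //.
  by have [] : prestr t A (x, y) by rewrite -st.
- case=> [[y sxy By] Ax]; split => //; exists y => //.
  by have [] : prestr s A (x, y) by rewrite st.
Qed.

End PartialBijections.

Section Definitions.
Variable C : lcCategory.

(* The graph of the partial bijection src(c) C -> c C, x |-> c x. *)
Definition lmul (c : C) : set (C * C) :=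
  [set p | src c = tgt p.1 /\ p.2 = comp c p.1].

(* I_l as a set of (graphs of) partial bijections. *)
Inductive in_Il : set (C * C) -> Prop :=
| Il_lmul c : in_Il (lmul c)
| Il_pmul s t : in_Il s -> in_Il t -> in_Il (pmul s t)
| Il_pinv s : in_Il s -> in_Il (pinv s).

Lemma in_Il_pbij s : in_Il s -> is_pbij s.
Proof.
elim=> {s} [c|s t _ [sf si] _ [tf ti]|s _ [sf si]].
- split=> x y z; first by move=> [/= _ ->] [/= _ ->].
  by move=> [/= cx ->] [/= cy]; exact: lc_cancel.
- split=> x y z.
    move=> [u xu uy] [v xv vz]; have uv := tf _ _ _ xu xv; subst v.
    exact: sf uy vz.
  move=> [u xu uy] [v xv vz]; have uv := si _ _ _ uy vz; subst v.
  exact: ti xu xv.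
- by split=> x y z; [exact: si | exact: sf].
Qed.

Definition Il : Type := [set s | in_Il s].

Definition Jset : set (set C) := [set pdom s | s in in_Il].
Definition J : Type := Jset.

Definition Ilset (s : Il) : set (C * C) := val s.
Definition Jcarrier (e : J) : set C := val e.
Coercion Ilset : Il >-> set.
Coercion Jcarrier : J >-> set.

Lemma IlP (s : Il) : in_Il s. Proof. exact: set_mem (valP s). Qed.
Lemma Il_pbij (s : Il) : is_pbij s. Proof. exact: in_Il_pbij (IlP s). Qed.
Lemma JP (e : J) : Jset e. Proof. exact: set_mem (valP e). Qed.
Lemma Il_inj (s t : Il) : s = t :> set _ -> s = t. Proof. exact: val_inj. Qed.
Lemma J_inj (e f : J) : e = f :> set _ -> e = f. Proof. exact: val_inj. Qed.

Definition mkIl s (h : in_Il s) : Il := SigSub (mem_set h).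
Definition mkJ e (h : Jset e) : J := SigSub (mem_set h).

Definition Ilmul (s t : Il) : Il := mkIl (Il_pmul (IlP s) (IlP t)).
Definition Ilinv (s : Il) : Il := mkIl (Il_pinv (IlP s)).

(* dom s, identified with the idempotent s^-1 s. *)
Definition Ildom (s : Il) : J :=
  mkJ (ex_intro2 _ _ (s : set _) (IlP s) (erefl _)).

Lemma Jset_setI (e f : J) : Jset ((e : set C) `&` f).
Proof.
have [s sI se] := JP e; have [t tI tf] := JP f.
exists (pmul t (pmul (pinv s) s)).
  by apply: Il_pmul => //; apply: Il_pmul => //; exact: Il_pinv.
by rewrite pdom_mul ppreim_idem ?se ?tf//; exact: in_Il_pbij.
Qed.

Definition Jmeet (e f : J) : J := mkJ (Jset_setI e f).

Lemma Jset_preim (s : Il) (e : J) : Jset (ppreim s e).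
Proof.
have [t tI te] := JP e; exists (pmul t s); first exact: Il_pmul tI (IlP s).
by rewrite pdom_mul te.
Qed.

(* s^-1 e s in the semilattice of idempotents, i.e. the set of all x in dom s
   with s x in e. *)
Definition Jconj (s : Il) (e : J) : J := mkJ (Jset_preim s e).

(** * The space Omega *)

Definition Jhat : set {ptws J -> bool} :=
  [set chi : {ptws J -> bool} | [/\ exists e, chi e,
     forall e f, chi (Jmeet e f) = chi e && chi f &
     forall e : J, e = set0 :> set C -> chi e = false]].

Definition Omega_set : set {ptws J -> bool} :=
  [set chi : {ptws J -> bool} | Jhat chi /\
     forall (e : J) (n : nat) (f : 'I_n -> J),
       e = \bigcup_i (f i : set C) :> set C -> chi e -> exists i, chi (f i)].

Definition Omega : Type := set_type Omega_set.
HB.instance Definition _ := Topological.copy Omega (set_type Omega_set).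

Definition Ochar (chi : Omega) : J -> bool := val chi.
Coercion Ochar : Omega >-> Funclass.

Lemma OmegaP (chi : Omega) : Omega_set (chi : J -> bool).
Proof. exact: set_mem (valP chi). Qed.

Lemma Omega_inj (chi psi : Omega) : (forall e, chi e = psi e) -> chi = psi.
Proof. by move=> h; apply: val_inj; apply/funext => e; exact: h. Qed.

Definition Oact_fun (s : Il) (chi : J -> bool) : J -> bool :=
  fun e => chi (Jconj s e).

Lemma Oact_subproof (s : Il) (chi : Omega) :
  chi (Ildom s) -> Omega_set (Oact_fun s chi).
Proof.
have [[_ chiM chi0] chiU] := OmegaP chi.
move=> cs; split; [split|].
- exists (Ildom (Ilinv s)); rewrite /Oact_fun.
  suff -> : Jconj s (Ildom (Ilinv s)) = Ildom s by [].
  by apply: J_inj; exact: ppreim_inv_dom (Il_pbij s).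
- move=> e f; rewrite /Oact_fun -chiM; congr (chi _).
  by apply: J_inj; exact: ppreimI (Il_pbij s).
- move=> e e0; rewrite /Oact_fun chi0//.
  by rewrite /Jcarrier/= e0 ppreim0.
- move=> e n f ef; apply: chiU.
  by rewrite {1}/Jcarrier/= ef ppreim_bigcup.
Qed.

(* s.chi = chi(s^-1 . s), for chi(s^-1 s) = 1. *)
Definition Oact (s : Il) (chi : Omega) (h : chi (Ildom s)) : Omega :=
  SigSub (mem_set (Oact_subproof h)).

Lemma OactE s chi h e : @Oact s chi h e = chi (Jconj s e). Proof. by []. Qed.

(* [Jbar_one chi eps]: eps belongs to Jbar and chi(eps) = 1.  By [Jbar_oneP]
   below, this does not depend on the way eps is written.  The case n = 0
   gives J as a subset of Jbar. *)
Definition Jbar_one (chi : Omega) : set (set C) :=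
  [set eps | exists (e : J) (n : nat) (f : 'I_n -> J),
    [/\ forall i, (f i : set C) `<=` e,
        eps = (e : set C) `\` \bigcup_i (f i : set C),
        chi e & forall i, ~~ chi (f i)]].

Definition J_one (chi : Omega) : set (set C) :=
  [set Jcarrier e | e in [set e | chi e]].

(** * Germs *)

(* Pairs (s, chi) with chi(s^-1 s) = 1, topologised as a subspace of the
   product of the discrete space I_l and Omega. *)
Definition germ_dom : set (discrete_topology Il * Omega) :=
  [set p : discrete_topology Il * Omega | p.2 (Ildom p.1)].
Definition germ_pair : Type := set_type germ_dom.
HB.instance Definition _ := Topological.copy germ_pair (set_type germ_dom).

Definition pair_elt (p : germ_pair) : Il := (val p).1.
Definition pair_chi (p : germ_pair) : Omega := (val p).2.
Definition mk_pair (s : Il) (chi : Omega) (h : chi (Ildom s)) : germ_pair :=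
  SigSub (mem_set (h : germ_dom (s, chi))).

Lemma pairP (p : germ_pair) : pair_chi p (Ildom (pair_elt p)).
Proof. exact: set_mem (valP p). Qed.

Lemma pairE (p : germ_pair) : mk_pair (pairP p) = p.
Proof. by apply: val_inj => /=; rewrite [RHS]surjective_pairing. Qed.

Lemma mk_pair_eq (s t : Il) (chi psi : Omega) (h : chi (Ildom s)) (h' : psi (Ildom t)) :
  s = t -> chi = psi -> mk_pair h = mk_pair h'.
Proof. by move=> st cp; apply: val_inj; rewrite /= st cp. Qed.

(* Germs with respect to the sets eps in [E chi]; the relations ~ and its
   barred variant are the cases [E = J_one] and [E = Jbar_one]. *)
Definition same_germ (E : Omega -> set (set C)) (p q : germ_pair) : Prop :=
  pair_chi p = pair_chi q /\
  exists2 eps, E (pair_chi p) eps &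
    prestr (pair_elt p) eps = prestr (pair_elt q) eps.

(* The properties of [J_one] and [Jbar_one] that make germs a groupoid. *)
Record germ_base (E : Omega -> set (set C)) : Prop := GermBase {
  gb_J : forall (chi : Omega) (e : J), chi e -> E chi e;
  gb_I : forall chi a b, E chi a -> E chi b -> E chi (a `&` b);
  gb_le : forall (chi : Omega) (e f : J) a, E chi a ->
    (e : set C) `&` a `<=` f -> chi e -> chi f;
  gb_pre : forall (s : Il) (chi : Omega) (h : chi (Ildom s)) a,
    E (Oact h) a -> E chi (ppreim s a);
  gb_open : forall a, open [set chi | E chi a]
}.

Lemma OmegaN0 (chi : Omega) : exists e, chi e.
Proof. by have [[]] := OmegaP chi. Qed.

Lemma OmegaM (chi : Omega) e f : chi (Jmeet e f) = chi e && chi f.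
Proof. by have [[]] := OmegaP chi. Qed.

Lemma Omega_cover (chi : Omega) (e : J) (n : nat) (f : 'I_n -> J) :
  (e : set C) `<=` \bigcup_i (f i : set C) -> chi e -> exists i, chi (f i).
Proof.
move=> ef ce; have [_ /(_ e n (fun i => Jmeet e (f i)))] := OmegaP chi.
case=> [|//|i]; last by rewrite OmegaM => /andP[_]; exists i.
apply/seteqP; split=> x; first by move=> ex; have [i _ fx] := ef _ ex; exists i.
by case=> i _ [].
Qed.

Lemma Omega_le (chi : Omega) (e f : J) :
  (e : set C) `<=` f -> chi e -> chi f.
Proof.
move=> ef; suff -> : e = Jmeet e f by rewrite OmegaM => /andP[].
by apply: J_inj; rewrite [RHS]setIidl.
Qed.

Lemma open_eval (e : J) (b : bool) : open [set chi : Omega | chi e = b].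
Proof.
have/continuousP/(_ [set b]) ce : continuous (fun chi : Omega => chi e).
  move=> chi; apply: (@continuous_comp _ _ _
    (set_val : Omega -> {ptws J -> bool}) (fun g : {ptws J -> bool} => g e)).
    exact: initial_continuous.
  exact: (@proj_continuous J (fun=> bool) e).
exact/ce/discrete_open.
Qed.

Lemma J_one_base : germ_base J_one.
Proof.
split.
- by move=> chi e ce; exists e.
- move=> chi _ _ [e /= ce <-] [f /= cf <-]; exists (Jmeet e f) => //=.
  by rewrite OmegaM ce cf.
- move=> chi e f _ [g /= cg <-] egf ce.
  by apply: (@Omega_le _ (Jmeet e g)) => //; rewrite OmegaM ce cg.
- by move=> s chi h _ [e /= ce <-]; exists (Jconj s e).
- move=> a.
  rewrite (_ : [set chi | _] =
    \bigcup_(e in [set e : J | e = a :> set _]) [set chi : Omega | chi e = true]).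
    by apply: bigcup_open => e _; exact: open_eval.
  by apply/seteqP; split=> chi /= [e ? ?]; exists e.
Qed.

Lemma Jbar_one_base : germ_base Jbar_one.
Proof.
split.
- move=> chi e ce; exists e, 0, (fun=> e); split => //; try by case.
  by apply/seteqP; split=> [x ex|x []//]; split=> // -[[]].
- move=> chi _ _ [e [n [f [fe -> ce cf]]]] [e' [n' [f' [fe' -> ce' cf']]]].
  exists (Jmeet e e'), (n + n')%N, (fun i : 'I_(n + n') => match fintype.split i with
    | inl i => Jmeet (f i) e' | inr j => Jmeet e (f' j) end); split.
  + move=> i x; case: (fintype.split i) => j [].
      by move=> /fe.
    by move=> ex /fe'.
  + apply/seteqP; split=> x.
    * case=> -[ex nf] [e'x nf']; split => // -[i _].
      by case: (fintype.split i) => j [fx f'x]; [apply: nf | apply: nf']; exists j.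
    * case=> -[ex e'x] nf; split; split => // -[i _ fx]; apply: nf.
        by exists (lshift n' i) => //; rewrite -/(unsplit (inl i)) unsplitK.
      by exists (rshift n i) => //; rewrite -/(unsplit (inr i)) unsplitK.
  + by rewrite OmegaM ce ce'.
  + move=> i; case: (fintype.split i) => j; rewrite OmegaM negb_and ?cf ?cf'//.
    by rewrite orbT.
- move=> chi e f _ [g [n [h [hg -> cg ch]]]] egf ce.
  have := @Omega_cover chi (Jmeet e g) n.+1
    (fun i => if unlift ord0 i is Some j then h j else f).
  case.
  + move=> x [ex gx]; have [[i _ hx]|nh] := pselect ((\bigcup_i (h i : set C)) x).
      by exists (lift ord0 i) => //; rewrite liftK.
    by exists ord0; rewrite // unlift_none; apply: egf.
  + by rewrite OmegaM ce cg.
  + by move=> i; case: unliftP => [j _|//]; rewrite (negbTE (ch j)).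
- move=> s chi h _ [e [n [f [fe -> ce cf]]]].
  exists (Jconj s e), n, (fun i => Jconj s (f i)); split => //.
  + by move=> i x [y sxy fy]; exists y => //; exact: fe fy.
  + by rewrite ppreimD ?ppreim_bigcup//; exact: Il_pbij.
- move=> a.
  rewrite (_ : [set chi | _] = \bigcup_(p in
     [set p : {e : J & {n : nat & 'I_n -> J}} |
       (forall i, (projT2 (projT2 p) i : set C) `<=` projT1 p) /\
       a = (projT1 p : set C) `\` \bigcup_i (projT2 (projT2 p) i : set C)])
     ([set chi : Omega | chi (projT1 p) = true] `&`
      \bigcap_(i in [set: 'I_(projT1 (projT2 p))])
        [set chi : Omega | chi (projT2 (projT2 p) i) = false])).
    apply: bigcup_open => -[e [n f]] _; apply: openI; first exact: open_eval.
    rewrite (_ : [set: _] = [set` enum 'I_n]); last first.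
      by apply/seteqP; split=> // i _ /=; rewrite mem_enum.
    rewrite bigcap_seq.
    by apply: big_ind => // *; [exact: openT | exact: openI | exact: open_eval].
  apply/seteqP; split=> chi /=.
  + move=> [e [n [f [fe ae ce cf]]]]; exists (existT _ e (existT _ n f)) => //.
    by split => // i _; exact/negbTE.
  + case=> -[e [n f]] /= [fe ae] [ce cf]; exists e, n, f; split => // i.
    by rewrite cf.
Qed.

Lemma Jbar_oneP (chi : Omega) (e : J) n (f : 'I_n -> J) :
  (forall i, (f i : set C) `<=` e) ->
  Jbar_one chi ((e : set C) `\` \bigcup_i (f i : set C)) <->
  chi e /\ forall i, ~~ chi (f i).
Proof.
move=> fe; split=> [h|[ce cf]]; last by exists e, n, f.
have [g cg] := OmegaN0 chi; split.
  by apply: (gb_le Jbar_one_base h _ cg) => x [_ []].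
move=> i; apply/negP => cfi.
have [e' [n' [f' [fe' ee' ce' cf']]]] := h.
have [||j] := @Omega_cover chi (Jmeet (f i) e') n' f'.
- move=> x [fx ex]; apply: contrapT => nf'.
  have [_] : ((e : set C) `\` \bigcup_i (f i : set C)) x by rewrite ee'.
  by apply; exists i.
- by rewrite OmegaM cfi ce'.
- exact/negP.
Qed.

Lemma Oact_continuous (s : Il) (U : set Omega) : open U ->
  open [set chi : Omega | exists h : chi (Ildom s), U (Oact h)].
Proof.
move=> [V oV VU].
have /continuousP/(_ V oV) oW : continuous
    (fun chi : Omega => Oact_fun s chi : {ptws J -> bool}).
  move=> chi; apply/cvg_sup; first exact/fmap_filter/nbhs_filter.
  move=> e B [V' [[W oW <-] We] V'B].
  apply: (filterS V'B); first exact/fmap_filter/nbhs_filter.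
  rewrite nbhs_simpl/=.
  suff : nbhs chi [set psi : Omega | psi (Jconj s e) = Ochar chi (Jconj s e)].
    move/filterS; apply => psi /= pe.
    by rewrite /preimage/= /Oact_fun pe.
  by apply: open_nbhs_nbhs; split => //; exact: open_eval.
rewrite (_ : mkset _ = [set chi : Omega | chi (Ildom s) = true] `&`
    ((fun chi : Omega => Oact_fun s chi) @^-1` V)).
  by apply: openI => //; exact: open_eval.
rewrite -VU; apply/seteqP; split=> chi /=.
- by move=> [h]; rewrite set_valE.
- by move=> [h]; exists h; rewrite set_valE.
Qed.

Section GermGroupoid.
Variables (E : Omega -> set (set C)) (hE : germ_base E).

Lemma same_germ_refl p : same_germ E p p.
Proof.
by split => //; exists (Ildom (pair_elt p)) => //; exact: gb_J (pairP p).
Qed.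

Lemma same_germ_sym p q : same_germ E p q -> same_germ E q p.
Proof. by move=> [pq [a Ea e]]; split => //; exists a; rewrite -?pq. Qed.

Lemma same_germ_trans q p r :
  same_germ E p q -> same_germ E q r -> same_germ E p r.
Proof.
move=> [pq [a Ea ea]] [qr [b Eb eb]]; split; first by rewrite pq.
exists (a `&` b); first by apply: gb_I => //; rewrite pq.
by rewrite -prestrE ea prestrE setIC -prestrE eb prestrE.
Qed.

Definition germ_rel : rel germ_pair := fun p q => `[< same_germ E p q >].

Lemma germ_rel_equiv : equiv_class_of germ_rel.
Proof.
split.
- by move=> p; apply/asboolP; exact: same_germ_refl.
- by move=> p q; apply/asboolP/asboolP => /same_germ_sym.
- move=> q p r /asboolP pq /asboolP qr; apply/asboolP.
  exact: same_germ_trans pq qr.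
Qed.

Definition germ_equiv : equiv_rel germ_pair := EquivRelPack germ_rel_equiv.

(* As a quotient of a disjoint union of the spaces {s} x Omega(s^-1 s), the
   space of germs has the topology described in [germ_slice_homeo]. *)
Definition germ : topologicalType := quotient_topology {eq_quot germ_equiv}.

Definition germ_pi : germ_pair -> germ := \pi_{eq_quot germ_equiv}.
Definition germ_repr : germ -> germ_pair := @repr _ {eq_quot germ_equiv}.

Definition germ_of (s : Il) (chi : Omega) (h : chi (Ildom s)) : germ :=
  germ_pi (mk_pair h).

Lemma germ_reprK g : germ_pi (germ_repr g) = g.
Proof. exact: reprK. Qed.

Lemma germ_piP p q : germ_pi p = germ_pi q <-> same_germ E p q.
Proof.
split; first by move=> h; apply/asboolP; exact/(@eqmodP _ germ_equiv).
by move=> /asboolP h; apply/(@eqmodP _ germ_equiv).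
Qed.

Lemma germ_repr_pi p : same_germ E (germ_repr (germ_pi p)) p.
Proof. by apply/germ_piP; rewrite germ_reprK. Qed.

Lemma germ_ind (P : germ -> Prop) :
  (forall (s : Il) (chi : Omega) (h : chi (Ildom s)), P (germ_of h)) ->
  forall g, P g.
Proof.
move=> Pof g; have := Pof _ _ (pairP (germ_repr g)).
by rewrite /germ_of pairE germ_reprK.
Qed.

Lemma germ_of_eq (s t : Il) (chi : Omega) (hs : chi (Ildom s))
    (ht : chi (Ildom t)) a : E chi a -> prestr s a = prestr t a ->
  germ_of hs = germ_of ht.
Proof. by move=> Ea st; apply/germ_piP; split => //; exists a. Qed.

Lemma germ_of_inj (s t : Il) (chi psi : Omega) (hs : chi (Ildom s))
    (ht : psi (Ildom t)) : germ_of hs = germ_of ht ->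
  chi = psi /\ exists2 a, E chi a & prestr s a = prestr t a.
Proof. by move/germ_piP. Qed.

Lemma germ_of_irr (s t : Il) (chi psi : Omega) (hs : chi (Ildom s))
    (ht : psi (Ildom t)) : s = t -> chi = psi -> germ_of hs = germ_of ht.
Proof. by move=> st cp; congr germ_pi; exact: mk_pair_eq. Qed.

Lemma Oact_germ (s t : Il) (chi psi : Omega) (hs : chi (Ildom s))
    (ht : psi (Ildom t)) : germ_of hs = germ_of ht -> Oact hs = Oact ht.
Proof.
move=> /germ_of_inj [cp]; subst psi => -[a Ea st]; apply: Omega_inj => e.
rewrite !OactE; have := prestr_ppreim (e : set C) st => ste.
apply/idP/idP; apply: (gb_le hE Ea) => x.
  by move=> h; have [] : (ppreim t e `&` a) x by rewrite -ste.
by move=> h; have [] : (ppreim s e `&` a) x by rewrite ste.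
Qed.

Definition germ_src (g : germ) : Omega := pair_chi (germ_repr g).
Definition germ_rng (g : germ) : Omega := Oact (pairP (germ_repr g)).

Definition germ_mul (g h : germ) : germ :=
  let st := Ilmul (pair_elt (germ_repr g)) (pair_elt (germ_repr h)) in
  if pselect (germ_src h (Ildom st)) is left k then germ_of k else g.

Lemma Ilinv_dom (s : Il) (chi : Omega) (h : chi (Ildom s)) :
  Oact h (Ildom (Ilinv s)).
Proof.
rewrite OactE; suff -> : Jconj s (Ildom (Ilinv s)) = Ildom s by [].
by apply: J_inj; exact: ppreim_inv_dom (Il_pbij s).
Qed.

Definition germ_inv (g : germ) : germ :=
  germ_of (Ilinv_dom (pairP (germ_repr g))).

Lemma Ilidem_ex (chi : Omega) :
  exists s : Il, chi (Ildom (Ilmul (Ilinv s) s)).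
Proof.
have [e ce] := OmegaN0 chi; have [s sI se] := JP e; exists (mkIl sI).
suff -> : Ildom (Ilmul (Ilinv (mkIl sI)) (mkIl sI)) = e by [].
by apply: J_inj; rewrite -[RHS]se; exact: pdom_idem (in_Il_pbij sI).
Qed.

Definition germ_one (chi : Omega) : germ := germ_of (projT2 (cid (Ilidem_ex chi))).

Lemma germ_srcE (s : Il) (chi : Omega) (h : chi (Ildom s)) :
  germ_src (germ_of h) = chi.
Proof. by have [] := germ_repr_pi (mk_pair h). Qed.

Lemma germ_rngE (s : Il) (chi : Omega) (h : chi (Ildom s)) :
  germ_rng (germ_of h) = Oact h.
Proof.
apply: Oact_germ; rewrite {1}/germ_of pairE; exact: germ_reprK.
Qed.

Lemma Ilmul_dom (s t : Il) (chi : Omega) (ht : chi (Ildom t)) :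
  Oact ht (Ildom s) = chi (Ildom (Ilmul s t)).
Proof.
by rewrite OactE; congr (chi _); apply: J_inj; rewrite /Jcarrier/= pdom_mul.
Qed.

Lemma germ_mulE (s t : Il) (chi : Omega) (ht : chi (Ildom t))
    (hs : Oact ht (Ildom s)) (hst : chi (Ildom (Ilmul s t))) :
  germ_mul (germ_of hs) (germ_of ht) = germ_of hst.
Proof.
rewrite /germ_mul germ_srcE.
have [] := germ_repr_pi (mk_pair hs); have [] := germ_repr_pi (mk_pair ht).
have := germ_rngE ht; rewrite /germ_rng.
move: (pairP _); rewrite -/(germ_of ht) -/(germ_of hs).
move: (germ_repr (germ_of ht)) (germ_repr (germ_of hs)) => q p hq qt.
rewrite /mk_pair/pair_chi/pair_elt/= -/(pair_chi q) -/(pair_elt q).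
rewrite -/(pair_chi p) -/(pair_elt p).
move=> qchi [b Eb tb] pchi [a Ea sa].
case: pselect => [k|nk]; last first.
  case: nk; have := pairP p; rewrite pchi -qt Ilmul_dom.
  by rewrite -qchi.
apply: (@germ_of_eq _ _ _ _ _ (b `&` ppreim t a)).
  apply: gb_I => //; first by rewrite -qchi.
  by apply: (gb_pre hE (h := ht)); rewrite -pchi.
apply/seteqP; split=> -[x z].
- move=> [[y qxy pyz] [bx [y' txy' ay']]]; split; last by split=> //; exists y'.
  have [txy _] : prestr t b (x, y) by rewrite -tb.
  have [fun_t _] := Il_pbij t.
  have yy' := fun_t _ _ _ txy txy'; subst y'.
  exists y => //; suff [] : prestr s a (y, z) by [].
  by rewrite -sa.
- move=> [[y txy pyz] [bx [y' txy' ay']]]; split; last by split=> //; exists y'.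
  have [qxy _] : prestr (pair_elt q) b (x, y) by rewrite tb.
  have [fun_t _] := Il_pbij t.
  have yy' := fun_t _ _ _ txy txy'; subst y'.
  exists y => //; suff [] : prestr (pair_elt p) a (y, z) by [].
  by rewrite sa.
Qed.

Lemma germ_oneE (s : Il) (chi : Omega) (h : chi (Ildom (Ilmul (Ilinv s) s))) :
  germ_one chi = germ_of h.
Proof.
rewrite /germ_one; case: (cid _) => t /= ht.
apply: (@germ_of_eq _ _ _ _ _ (Jmeet (Ildom s) (Ildom t))).
  apply: gb_J => //; rewrite OmegaM; move: h ht.
  have -> (u : Il) : Ildom (Ilmul (Ilinv u) u) = Ildom u.
    by apply: J_inj; exact: pdom_idem (Il_pbij u).
  have -> (u : Il) : Ildom (Ilmul (Ilinv u) u) = Ildom u.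
    by apply: J_inj; exact: pdom_idem (Il_pbij u).
  by move=> -> ->.
rewrite /Ilset/= -/(Ilset s) -/(Ilset t).
rewrite !pmul_idemE; [|exact: Il_pbij..].
by apply/seteqP; split=> -[x y] /= [[xy _] [sx tx]].
Qed.

Lemma germ_invE (s : Il) (chi : Omega) (h : chi (Ildom s))
    (h' : Oact h (Ildom (Ilinv s))) :
  germ_inv (germ_of h) = germ_of h'.
Proof.
have := germ_repr_pi (mk_pair h); rewrite -/(germ_of h) /germ_inv.
move: (pairP _) (germ_rngE h); rewrite /germ_rng => hp.
move: (Ilinv_dom _); rewrite (Prop_irrelevance (pairP _) hp).
move: (germ_repr _) hp => p hp h1 e [pc [a Ea sa]].
have {}sa : prestr (pair_elt p) a = prestr s a by [].
have {}pc : pair_chi p = chi by [].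
apply/germ_piP; split => //; exists (ppreim (Ilinv s) a).
- change (E (Oact hp) (ppreim (Ilinv s) a)); rewrite e.
  apply: (gb_pre hE (h := h')); suff -> : Oact h' = pair_chi p by [].
  apply: Omega_inj => f; rewrite !OactE pc.
  have := OmegaM chi (Ildom s) f; rewrite h /= => <-; congr (chi _).
  by apply: J_inj; rewrite /Jcarrier/= ppreimV//; exact: Il_pbij.
- apply/seteqP; split=> -[y x] /= [pxy [x' sx'y ax']]; split; try by exists x'.
  + have [px'y _] : prestr (pair_elt p) a (x', y) by rewrite sa.
    have [_ ip] := Il_pbij (pair_elt p).
    have /= xx := ip _ _ _ pxy px'y; by subst x'.
  + have [px'y _] : prestr (pair_elt p) a (x', y) by rewrite sa.
    have [_ is_] := Il_pbij s.
    have /= xx := is_ _ _ _ pxy sx'y; by subst x'.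
Qed.

Lemma germ_mulP (P : germ -> germ -> germ -> Prop) :
  (forall (s t : Il) (chi : Omega) (ht : chi (Ildom t))
     (hs : Oact ht (Ildom s)) (hst : chi (Ildom (Ilmul s t))),
     P (germ_of hs) (germ_of ht) (germ_of hst)) ->
  forall g h, germ_src g = germ_rng h -> P g h (germ_mul g h).
Proof.
move=> Pof; elim/germ_ind => s psi hs; elim/germ_ind => t chi ht.
rewrite germ_srcE germ_rngE => e; subst psi.
have hst : chi (Ildom (Ilmul s t)) by rewrite -(Ilmul_dom s ht).
by rewrite (germ_mulE hs hst); exact: Pof.
Qed.

Lemma Oact_mul (s t : Il) (chi : Omega) (ht : chi (Ildom t))
    (hs : Oact ht (Ildom s)) (hst : chi (Ildom (Ilmul s t))) :
  Oact hst = Oact hs.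
Proof.
apply: Omega_inj => e; rewrite !OactE; congr (chi _); apply: J_inj.
exact: ppreim_mul.
Qed.

Lemma Ilidem_dom (s : Il) : Ildom (Ilmul (Ilinv s) s) = Ildom s.
Proof. by apply: J_inj; exact: pdom_idem (Il_pbij s). Qed.

Lemma Oact_idem (s : Il) (chi : Omega) (h : chi (Ildom (Ilmul (Ilinv s) s))) :
  Oact h = chi.
Proof.
apply: Omega_inj => e; rewrite OactE; move: (h); rewrite Ilidem_dom => h'.
have := OmegaM chi (Ildom s) e; rewrite h' /= => <-; congr (chi _).
by apply: J_inj; exact: ppreim_idem (Il_pbij s).
Qed.

Lemma germ_oneW (chi : Omega) : exists (s : Il)
  (h : chi (Ildom (Ilmul (Ilinv s) s))), germ_one chi = germ_of h.
Proof. by exists (projT1 (cid (Ilidem_ex chi))), (projT2 (cid (Ilidem_ex chi))). Qed.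

Lemma germ_src_one chi : germ_src (germ_one chi) = chi.
Proof. by have [s [h ->]] := germ_oneW chi; rewrite germ_srcE. Qed.

Lemma germ_rng_one chi : germ_rng (germ_one chi) = chi.
Proof. by have [s [h ->]] := germ_oneW chi; rewrite germ_rngE Oact_idem. Qed.

Lemma germ_src_mul g h : germ_src g = germ_rng h ->
  germ_src (germ_mul g h) = germ_src h.
Proof.
move: g h; apply: (germ_mulP (P := fun g h k => germ_src k = germ_src h)).
by move=> *; rewrite !germ_srcE.
Qed.

Lemma germ_rng_mul g h : germ_src g = germ_rng h ->
  germ_rng (germ_mul g h) = germ_rng g.
Proof.
move: g h; apply: (germ_mulP (P := fun g h k => germ_rng k = germ_rng g)).
by move=> *; rewrite !germ_rngE; exact: Oact_mul.
Qed.

Lemma germ_mulA g h k : germ_src g = germ_rng h -> germ_src h = germ_rng k ->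
  germ_mul g (germ_mul h k) = germ_mul (germ_mul g h) k.
Proof.
elim/germ_ind: g => s c1 hs; elim/germ_ind: h => t c2 ht.
elim/germ_ind: k => u chi hu.
rewrite !germ_srcE !germ_rngE => e1 e2; subst c2; subst c1.
have htu : chi (Ildom (Ilmul t u)) by rewrite -(Ilmul_dom t hu).
have hst : Oact hu (Ildom (Ilmul s t)) by rewrite -(Ilmul_dom s ht).
have hs' : Oact htu (Ildom s) by rewrite (Oact_mul ht htu).
have h1 : chi (Ildom (Ilmul s (Ilmul t u))) by rewrite -(Ilmul_dom s htu).
have h2 : chi (Ildom (Ilmul (Ilmul s t) u)).
  by rewrite -(Ilmul_dom (Ilmul s t) hu).
rewrite (germ_mulE ht htu) (germ_mulE hs hst) (germ_mulE hst h2).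
rewrite (germ_of_irr hs hs' erefl (esym (Oact_mul ht htu))) (germ_mulE hs' h1).
apply: germ_of_irr => //; apply: Il_inj; apply/seteqP; split=> -[x y] /=.
- by move=> [z [w xw wz] zy]; exists w => //; exists z.
- by move=> [w xw [z wz zy]]; exists z => //; exists w.
Qed.

Lemma germ_mul1g g : germ_mul (germ_one (germ_rng g)) g = g.
Proof.
elim/germ_ind: g => s chi hs; rewrite germ_rngE.
have h1 : Oact hs (Ildom (Ilmul (Ilinv (Ilinv s)) (Ilinv s))).
  by rewrite Ilidem_dom; exact: Ilinv_dom.
have h2 : chi (Ildom (Ilmul (Ilmul (Ilinv (Ilinv s)) (Ilinv s)) s)).
  by rewrite -(Ilmul_dom _ hs).
rewrite (germ_oneE h1) (germ_mulE h1 h2); apply: germ_of_irr => //.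
have [fs is_] := Il_pbij s.
apply: Il_inj; apply/seteqP; split=> -[x y] /=.
- by move=> [z xz [w wz wy]]; have /= xw := is_ _ _ _ xz wz; subst w.
- by move=> xy; exists y => //; exists x.
Qed.

Lemma germ_mulg1 g : germ_mul g (germ_one (germ_src g)) = g.
Proof.
elim/germ_ind: g => s chi hs; rewrite germ_srcE.
have h1 : chi (Ildom (Ilmul (Ilinv s) s)) by rewrite Ilidem_dom.
have h2 : Oact h1 (Ildom s) by rewrite Oact_idem.
have h3 : chi (Ildom (Ilmul s (Ilmul (Ilinv s) s))) by rewrite -(Ilmul_dom _ h1).
rewrite (germ_oneE h1) (germ_of_irr hs h2 erefl (esym (Oact_idem h1))).
rewrite (germ_mulE h2 h3); apply: germ_of_irr; last by rewrite Oact_idem.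
have [fs is_] := Il_pbij s.
apply: Il_inj; apply/seteqP; split=> -[x y] /=.
- by move=> [z [w xw zw] zy]; have /= xz := is_ _ _ _ xw zw; subst z.
- by move=> xy; exists x => //; exists y.
Qed.

Lemma germ_src_inv g : germ_src (germ_inv g) = germ_rng g.
Proof.
elim/germ_ind: g => s chi hs.
by rewrite (germ_invE (Ilinv_dom hs)) germ_srcE germ_rngE.
Qed.

Lemma Oact_inv (s : Il) (chi : Omega) (hs : chi (Ildom s))
  (h : Oact hs (Ildom (Ilinv s))) : Oact h = chi.
Proof.
have h1 : chi (Ildom (Ilmul (Ilinv s) s)) by rewrite Ilidem_dom.
by rewrite -(Oact_mul h h1) Oact_idem.
Qed.

Lemma germ_rng_inv g : germ_rng (germ_inv g) = germ_src g.
Proof.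
elim/germ_ind: g => s chi hs.
by rewrite (germ_invE (Ilinv_dom hs)) germ_srcE germ_rngE Oact_inv.
Qed.

Lemma germ_mulVg g : germ_mul (germ_inv g) g = germ_one (germ_src g).
Proof.
elim/germ_ind: g => s chi hs.
have h1 : chi (Ildom (Ilmul (Ilinv s) s)) by rewrite Ilidem_dom.
by rewrite (germ_invE (Ilinv_dom hs)) (germ_mulE _ h1) germ_srcE (germ_oneE h1).
Qed.

Lemma germ_mulgV g : germ_mul g (germ_inv g) = germ_one (germ_rng g).
Proof.
elim/germ_ind: g => s chi hs; have hV := Ilinv_dom hs.
have h1 : Oact hV (Ildom s) by rewrite Oact_inv.
have h2 : Oact hs (Ildom (Ilmul s (Ilinv s))) by rewrite -(Ilmul_dom _ hV).
have h3 : Oact hs (Ildom (Ilmul (Ilinv (Ilinv s)) (Ilinv s))).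
  by rewrite Ilidem_dom.
rewrite germ_rngE (germ_oneE h3) (germ_invE hV).
rewrite (germ_of_irr hs h1 erefl (esym (Oact_inv hV))) (germ_mulE h1 h2).
apply: germ_of_irr => //.
suff -> : Ilinv (Ilinv s) = s by [].
by apply: Il_inj; exact: pinvK.
Qed.

Lemma pair_openP (A : set germ_pair) : open A <->
  forall s, open [set chi : Omega | exists h : chi (Ildom s), A (mk_pair h)].
Proof.
split.
- move=> [B oB BA] s.
  rewrite (_ : mkset _ = [set chi : Omega | chi (Ildom s) = true] `&`
     [set chi : Omega | B ((s : discrete_topology Il), chi)]).
    apply: openI; first exact: open_eval.
    exact: open_xsection_at oB.
  rewrite -BA; apply/seteqP; split=> chi /=.
  + by move=> [h]; rewrite set_valE.
  + by move=> [h]; exists h; rewrite set_valE.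
- move=> oA.
  pose B := \bigcup_s [set p : discrete_topology Il * Omega | p.1 = s /\
     exists h : p.2 (Ildom s), A (mk_pair h)].
  exists B.
    apply: bigcup_open => s _.
    rewrite (_ : mkset _ = [set s] `*`
      [set chi : Omega | exists h : chi (Ildom s), A (mk_pair h)]) //.
    by apply: open_setX => //; exact: discrete_open.
  apply/seteqP; split=> p /=; rewrite set_valE.
  + move=> [s _ [ps [h Ap]]].
    suff <- : mk_pair h = p by [].
    by apply: val_inj; rewrite /= -ps -surjective_pairing.
  + by move=> Ap; exists (pair_elt p) => //; split => //; exists (pairP p); rewrite pairE.
Qed.

Lemma germ_openP (W : set germ) : open W <->
  forall s, open [set chi : Omega | exists h : chi (Ildom s), W (germ_of h)].
Proof. exact: (pair_openP (germ_pi @^-1` W)). Qed.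

(* The image of {s} x U. *)
Definition germ_slice (s : Il) (U : set Omega) : set germ :=
  [set g | exists2 chi : Omega, U chi &
     exists h : chi (Ildom s), g = germ_of h].

Lemma open_germ_slice (s : Il) (U : set Omega) : open U ->
  open (germ_slice s U).
Proof.
move=> oU; apply/germ_openP => t.
rewrite (_ : mkset _ = \bigcup_(a in [set a | prestr s a = prestr t a])
    ([set chi : Omega | chi (Ildom s) = true] `&`
     [set chi : Omega | chi (Ildom t) = true] `&` U `&` [set chi | E chi a])).
  apply: bigcup_open => a _; apply: openI; last exact: (gb_open hE).
  by apply: openI => //; apply: openI; exact: open_eval.
apply/seteqP; split=> chi /=.
- move=> [ht [psi Upsi [hs /esym /germ_of_inj [e [a Ea sa]]]]].
  by subst psi; exists a.
- move=> [a /= sa [[[hs ht] Uchi] Ea]]; exists ht, chi => //; exists hs.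
  by apply/esym/(germ_of_eq hs ht Ea).
Qed.

Lemma germ_src_continuous : continuous germ_src.
Proof.
apply/continuousP => U oU; apply/germ_openP => s.
rewrite (_ : mkset _ = [set chi : Omega | chi (Ildom s) = true] `&` U).
  by apply: openI => //; exact: open_eval.
apply/seteqP; split=> chi /=; first by move=> [h]; rewrite germ_srcE.
by move=> [h Uchi]; exists h; rewrite germ_srcE.
Qed.

(* The image of {s} x Omega(s^-1 s) is open, and the source map is a
   homeomorphism from it onto Omega(s^-1 s). *)
Lemma germ_slice_homeo (s : Il) :
  [/\ open (germ_slice s setT),
      germ_src @` germ_slice s setT = [set chi : Omega | chi (Ildom s)],
      {in germ_slice s setT &, injective germ_src},
      continuous germ_src &
      forall W, open W -> open (germ_src @` (W `&` germ_slice s setT))].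
Proof.
split; [exact/open_germ_slice/openT| | |exact: germ_src_continuous|].
- apply/seteqP; split=> chi /=.
    by move=> [_ [psi _ [h ->]] <-]; rewrite germ_srcE.
  by move=> h; exists (germ_of h); [exists chi => //; exists h|rewrite germ_srcE].
- move=> g g' /set_mem [chi _ [h ->]] /set_mem [psi _ [h' ->]].
  by rewrite !germ_srcE => e; exact: germ_of_irr.
- move=> W /germ_openP /(_ s); congr open; apply/seteqP; split=> chi /=.
    move=> [h Wh]; exists (germ_of h); last exact: germ_srcE.
    by split => //; exists chi => //; exists h.
  move=> [g [Wg [psi _ [h e]]] <-]; rewrite e germ_srcE.
  by exists h; rewrite -e.
Qed.

Lemma germ_rng_continuous : continuous germ_rng.
Proof.
apply/continuousP => U oU; apply/germ_openP => s.
rewrite (_ : mkset _ = [set chi : Omega | exists h : chi (Ildom s), U (Oact h)]).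
  exact: Oact_continuous.
by apply/seteqP; split=> chi /= [h]; [rewrite germ_rngE|rewrite -germ_rngE];
  exists h.
Qed.

Lemma germ_one_continuous : continuous germ_one.
Proof.
apply/continuousP => W /germ_openP oW.
rewrite (_ : _ @^-1` _ = \bigcup_s [set chi : Omega |
    exists h : chi (Ildom (Ilmul (Ilinv s) s)), W (germ_of h)]).
  by apply: bigcup_open => s _.
apply/seteqP; split=> chi /=.
- by have [s [h ->]] := germ_oneW chi => Wh; exists s => //; exists h.
- by move=> [s _ [h]]; rewrite -germ_oneE.
Qed.

Lemma germ_inv_continuous : continuous germ_inv.
Proof.
apply/continuousP => W /germ_openP oW; apply/germ_openP => s.
have := Oact_continuous s (oW (Ilinv s)).
congr open; apply/seteqP; split=> chi /=.
- by move=> [h [h' Wh']]; exists h; rewrite (germ_invE h').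
- by move=> [h]; rewrite (germ_invE (Ilinv_dom h)); exists h, (Ilinv_dom h).
Qed.

Lemma germ_mul_continuous :
  {within [set p : germ * germ | germ_src p.1 = germ_rng p.2],
    continuous (fun p => germ_mul p.1 p.2)}.
Proof.
apply/subspace_continuousP => -[g0 h0] /= gh0 W0.
move=> nW0.
have [W [oW Wgh] WW0] : exists2 W, open_nbhs (germ_mul g0 h0) W & W `<=` W0.
  by have : nbhs (germ_mul g0 h0 : germ) W0 by []; rewrite nbhsE.
suff : nbhs (g0, h0) [set p : germ * germ |
    germ_src p.1 = germ_rng p.2 -> W (germ_mul p.1 p.2)].
  by apply: filterS => p Wp /Wp /WW0.
move: g0 h0 gh0 Wgh {nW0}; apply: (germ_mulP (P := fun g h k => W k ->
  nbhs (g, h) [set p : germ * germ |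
    germ_src p.1 = germ_rng p.2 -> W (germ_mul p.1 p.2)])).
move=> s t chi ht hs hst Wst.
pose U := [set psi : Omega | exists h : psi (Ildom (Ilmul s t)), W (germ_of h)].
have oU : open U by move/germ_openP: oW => /(_ (Ilmul s t)).
have N1 : nbhs (germ_of hs : germ) (germ_slice s setT).
  apply: open_nbhs_nbhs; split; first exact/open_germ_slice/openT.
  by exists (Oact ht) => //; exists hs.
have N2 : nbhs (germ_of ht : germ) (germ_slice t U).
  apply: open_nbhs_nbhs; split; first exact/open_germ_slice.
  by exists chi; [exists hst|exists ht].
exists (germ_slice s setT, germ_slice t U); first by split.
move=> [g h] /= [[psi _ [hs' ->]] [phi [hst' Wst'] [ht' ->]]].
rewrite germ_srcE germ_rngE => e; subst psi.
by rewrite (germ_mulE hs' hst').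
Qed.

Definition germ_groupoid : topGroupoid := TopGroupoid
  germ_src_one germ_rng_one germ_src_mul germ_rng_mul germ_mulA germ_mul1g
  germ_mulg1 germ_src_inv germ_rng_inv germ_mulVg germ_mulgV
  germ_src_continuous germ_rng_continuous germ_one_continuous
  germ_inv_continuous germ_mul_continuous.

End GermGroupoid.

Definition transformation_groupoid : topGroupoid :=
  germ_groupoid J_one_base.

Definition bar_transformation_groupoid : topGroupoid :=
  germ_groupoid Jbar_one_base.

Definition canonical_projection
    (g : transformation_groupoid) : bar_transformation_groupoid :=
  germ_pi Jbar_one_base (germ_repr g).

Lemma J_one_Jbar_one chi : J_one chi `<=` Jbar_one chi.
Proof. by move=> _ [e ce <-]; exact: (gb_J Jbar_one_base). Qed.

Lemma canonical_projectionE p :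
  canonical_projection (germ_pi J_one_base p) = germ_pi Jbar_one_base p.
Proof.
apply/germ_piP; have [c [a Ja ea]] := germ_repr_pi J_one_base p.
by split => //; exists a => //; exact: J_one_Jbar_one.
Qed.

End Definitions.

(* Main.v *)
Require Import Defs.
From mathcomp Require Import all_boot all_classical topology.

(** The projection is induced by enlarging the family of sets on which two
    germs are compared, so it is an isomorphism as soon as the two germ relations
    coincide: a comparison of germ relations always induces a continuous
    morphism ([change_base_continuous], [change_base_morphism]), and equal
    relations give two such morphisms inverse to each other.  What has to be
    shown is that equality of [s] and [t] on some [eps = e \ (f_1 u ... u f_n)]
    with [chi(eps) = 1] forces equality on some [e'] in J with [chi(e') = 1].

    Both cases rest on the fact that elements of I_l commute with right
    multiplication, so that [s x = t x] implies [s = t] on the whole ideal xC,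
    which belongs to J ([Il_agree_ideal]).

    If C is finitely aligned, every element of J is a finite union of
    principal right ideals ([in_Il_finitely_generated]). Write the
    intersection of e with the domain of s in this way. Since chi lies in
    Omega, [chi(cC) = 1] for one of these ideals cC. If c were in [f_i], then
    cC would be contained in [f_i], contradicting [chi(f_i) = 0]. So c lies in
    eps, where s and t agree, and cC is the required element of J.

    If the groupoid of germs is Hausdorff, the argument is one of density.  Every
    point x of C defines a character in Omega, [e |-> (x \in e)], and these are
    dense ([point_char_dense]), because no set eps with [chi(eps) = 1] is empty.
    At a point character with x in eps, s and t agree at x, hence on xC, and
    have the same germ.  If the germs at chi differed, they could be
    separated by disjoint open sets, so the germs of s and t would be different
    at all characters close to chi, including such point characters. *)

Set Implicit Arguments.
Unset Strict Implicit.

Local Open Scope classical_set_scope.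

Local Notation comp := Defs.comp.
Local Notation compA := Defs.compA.
Local Notation pinv := Defs.pinv.

(** * Equivariance of the elements of I_l *)

Section Equivariance.
Variable C : lcCategory.
Implicit Types (c d x y z : C) (s t : set (C * C)).

Lemma in_Il_equivariant s x y : in_Il s -> s (x, y) ->
  src x = src y /\
  forall z, src x = tgt z -> s (comp x z, comp y z).
Proof.
move=> sI; elim: sI x y => {s} [c|s t _ IHs _ IHt|s _ IHs] x y.
- move=> [/= cx ->]; split; first by rewrite src_comp.
  by move=> z xz; split => /=; [rewrite tgt_comp | rewrite compA].
- move=> [w /= /IHt [xw txw] /IHs [wy swy]]; split; first by rewrite xw.
  by move=> z xz; exists (comp w z) => /=; [apply: txw | apply: swy; rewrite -xw].
- move=> /= /IHs [yx syx]; split => // z xz.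
  by apply: syx; rewrite yx.
Qed.

Lemma right_ideal_refl c : right_ideal c c.
Proof. by exists (src c); [rewrite /= tgt_src | rewrite comp_src]. Qed.

Lemma right_ideal_src c : right_ideal (src c) = [set x | src c = tgt x].
Proof.
apply/seteqP; split=> x /=.
  by move=> [y /=]; rewrite src_src => cy <-; rewrite tgt_comp ?tgt_src ?src_src.
by move=> cx; exists x; rewrite /= ?src_src// cx comp_tgt.
Qed.

(** Elements of J are domains, so they absorb right multiplication. *)
Lemma J_right_ideal (e : J C) x : (e : set C) x -> right_ideal x `<=` e.
Proof.
have [s sI <-] := JP e => -[y sxy] _ [z /= xz <-].
by have [_ /(_ z xz) ?] := in_Il_equivariant sI sxy; exists (comp y z).
Qed.

Lemma Il_agree_ideal s t x y : in_Il s -> in_Il t -> s (x, y) -> t (x, y) ->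
  prestr s (right_ideal x) = prestr t (right_ideal x).
Proof.
have agree (r r' : set (C * C)) : in_Il r -> in_Il r' ->
    r (x, y) -> r' (x, y) ->
    prestr r (right_ideal x) `<=` prestr r' (right_ideal x).
  move=> rI r'I rxy r'xy [u v] /= [ruv xu]; split => //.
  case: xu ruv => z /= xz <- ruv.
  have [_ /(_ z xz) rz] := in_Il_equivariant rI rxy.
  have [_ /(_ z xz) r'z] := in_Il_equivariant r'I r'xy.
  by have [+ _] := in_Il_pbij rI => /(_ _ _ _ ruv rz) ->.
by move=> sI tI sxy txy; apply/seteqP; split; exact: agree.
Qed.

(** The ideal cC as the range of [x |-> c x]. *)
Definition Jideal c : J C := Ildom (Ilinv (mkIl (Il_lmul c))).

Lemma JidealE c : Jideal c = right_ideal c :> set C.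
Proof.
apply/seteqP; split=> y /=; first by move=> [x [/= cx ->]]; exists x.
by move=> [x /= cx <-]; exists x.
Qed.

(** An agreement of two elements of I_l at a single point x upgrades to an
    equality of germs in the strict sense at every character charging xC. *)
Lemma same_germ_at_point (p q : germ_pair C) (eps : set C) x :
  pair_chi p = pair_chi q ->
  prestr (pair_elt p) eps = prestr (pair_elt q) eps ->
  eps x -> pdom (pair_elt p) x -> pair_chi p (Jideal x) ->
  same_germ (@J_one C) p q.
Proof.
move=> pq pqeps epsx [y pxy] chix; split => //.
exists (right_ideal x); first by exists (Jideal x) => //; rewrite JidealE.
have [qxy _] : prestr (pair_elt q) eps (x, y) by rewrite -pqeps.
by apply: Il_agree_ideal pxy qxy; exact: IlP.
Qed.

End Equivariance.

(** * Finitely aligned categories *)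

Section FinitelyAligned.
Variable C : lcCategory.
Implicit Types (c d x y z : C) (s t : set (C * C)).

Definition finitely_generated (A : set C) : Prop :=
  exists2 F : set C, finite_set F & A = \bigcup_(c in F) right_ideal c.

Lemma finitely_generated0 : finitely_generated set0.
Proof. by exists set0 => //; rewrite bigcup_set0. Qed.

Lemma finitely_generated_ideal c : finitely_generated (right_ideal c).
Proof. by exists [set c]; [exact: finite_set1 | rewrite bigcup_set1]. Qed.

Lemma finitely_generated_bigcup (I : Type) (D : set I) (A : I -> set C) :
  finite_set D -> (forall i, D i -> finitely_generated (A i)) ->
  finitely_generated (\bigcup_(i in D) A i).
Proof.
move=> Dfin Afg.
have /choice[G GP] : forall i, exists F : set C, D i ->
    finite_set F /\ A i = \bigcup_(c in F) right_ideal c.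
  move=> i; have [/Afg[F ? ?]|nDi] := pselect (D i); first by exists F.
  by exists set0.
exists (\bigcup_(i in D) G i); first by apply: bigcup_finite => // i /GP[].
apply/seteqP; split=> x.
- move=> [i Di]; have [_ ->] := GP _ Di => -[c Gc cx].
  by exists c => //; exists i.
- move=> [c [i Di Gc] cx]; exists i => //.
  by have [_ ->] := GP _ Di; exists c.
Qed.

Definition pulls_finitely_generated s : Prop :=
  forall A, finitely_generated A -> finitely_generated (ppreim s A).

Lemma pulls_finitely_generated_ideals s :
  (forall c, finitely_generated (ppreim s (right_ideal c))) ->
  pulls_finitely_generated s.
Proof.
move=> sfg _ [F Ffin ->].
have -> : ppreim s (\bigcup_(c in F) right_ideal c) =
    \bigcup_(c in F) ppreim s (right_ideal c).
  apply/seteqP; split=> x /=.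
    by move=> [y sxy [c Fc cy]]; exists c => //; exists y.
  by move=> [c Fc [y sxy cy]]; exists y => //; exists c.
by apply: finitely_generated_bigcup => // c _; exact: sfg.
Qed.

(** This is where alignment enters: the pull-back of aC along [x |-> c x] is
    the intersection of aC with cC, divided by c on the left. *)
Lemma pulls_finitely_generated_lmul c : finitely_aligned C ->
  pulls_finitely_generated (lmul c).
Proof.
move=> /(_ c) fa; apply: pulls_finitely_generated_ideals => a.
have [F Ffin caF] := fa a.
have /choice[g gP] : forall d, exists d',
    F d -> src c = tgt d' /\ comp c d' = d.
  move=> d; have [Fd|nFd] := pselect (F d); last by exists d.
  have [[d' cd' <-] _] : (right_ideal c `&` right_ideal a) d.
    by rewrite caF; exists d => //; exact: right_ideal_refl.
  by exists d'.
suff -> : ppreim (lmul c) (right_ideal a) = \bigcup_(d in F) right_ideal (g d).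
  by apply: finitely_generated_bigcup => // d _; exact: finitely_generated_ideal.
apply/seteqP; split=> x /=.
- move=> [_ [/= cx ->] acx].
  have : (right_ideal c `&` right_ideal a) (comp c x) by split => //; exists x.
  rewrite caF => -[d Fd [y /= dy dycx]].
  have [cg cgd] := gP _ Fd.
  have gy : src (g d) = tgt y by rewrite -dy -{2}cgd src_comp.
  exists d => //; exists y => //.
  apply: (@lc_cancel C c); [by rewrite tgt_comp|by []|].
  by rewrite (compA cg gy) cgd.
- move=> [d Fd [y /= gy <-]]; have [cg cgd] := gP _ Fd.
  exists (comp c (comp (g d) y)); first by split => //=; rewrite tgt_comp.
  rewrite compA// cgd.
  suff [] : (right_ideal c `&` right_ideal a) (comp d y) by [].
  rewrite caF; exists d => //; exists y => //=.
  by rewrite -gy -{1}cgd src_comp.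
Qed.

Lemma pulls_finitely_generated_lmulV c :
  pulls_finitely_generated (pinv (lmul c)).
Proof.
apply: pulls_finitely_generated_ideals => a.
have [ca|nca] := pselect (src c = tgt a).
- suff -> : ppreim (pinv (lmul c)) (right_ideal a) = right_ideal (comp c a).
    exact: finitely_generated_ideal.
  apply/seteqP; split=> y /=.
  + move=> [_ [/= _ ->] [z /= az <-]]; exists z => /=; first by rewrite src_comp.
    by rewrite compA.
  + move=> [z /=]; rewrite src_comp// => az <-; exists (comp a z); last by exists z.
    by split => /=; rewrite ?tgt_comp// compA.
- suff -> : ppreim (pinv (lmul c)) (right_ideal a) = set0.
    exact: finitely_generated0.
  apply/seteqP; split=> y //= [x [/= cx _] [z /= az zx]]; apply: nca.
  by rewrite cx -zx tgt_comp.
Qed.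

Lemma pinv_pmul s t :
  pinv (pmul s t) = pmul (pinv t) (pinv s).
Proof. by apply/seteqP; split=> -[x y] /= [z ? ?]; exists z. Qed.

(** Inverses have to be carried along in the induction, because the
    generators of I_l and their inverses pull ideals back for different
    reasons. *)
Lemma in_Il_finitely_generated s : finitely_aligned C -> in_Il s ->
  [/\ pulls_finitely_generated s, pulls_finitely_generated (pinv s),
      finitely_generated (pdom s) & finitely_generated (pdom (pinv s))].
Proof.
move=> fa; elim=> {s} [c|s t _ [sp sVp sd sVd] _ [tp tVp td tVd]|s _ [? ? ? ?]].
- split; [exact: pulls_finitely_generated_lmul |
    exact: pulls_finitely_generated_lmulV | | ].
  + suff -> : pdom (lmul c) = right_ideal (src c).
      exact: finitely_generated_ideal.
    rewrite right_ideal_src; apply/seteqP; split=> x /=; first by move=> [y []].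
    by exists (comp c x).
  + by have := JidealE c; rewrite /Jcarrier/= => ->; exact: finitely_generated_ideal.
- rewrite pinv_pmul; split.
  + by move=> A /sp /tp; rewrite ppreim_mul.
  + by move=> A /tVp /sVp; rewrite ppreim_mul.
  + by rewrite pdom_mul; exact: tp.
  + by rewrite pdom_mul; exact: sVp.
- by split => //; rewrite pinvK.
Qed.

Lemma J_finitely_generated (e : J C) : finitely_aligned C ->
  finitely_generated e.
Proof.
move=> fa; have [s sI <-] := JP e.
by have [] := in_Il_finitely_generated fa sI.
Qed.

Lemma Omega_finitely_generated (chi : Omega C) (e : J C) (F : set C) :
  finite_set F -> (e : set C) = \bigcup_(c in F) right_ideal c ->
  chi e -> exists2 c, F c & chi (Jideal c).
Proof.
move=> /finite_setP[n /card_set_bijP[f [ffun finj fsurj]]] eF ce.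
have /choice[g gP] : forall i : 'I_n, exists c, F c /\ f c = i.
  by move=> i; have [c Fc fc] := fsurj i (ltn_ord i); exists c.
case: (@Omega_cover _ chi e n (fun i => Jideal (g i))) => //.
  rewrite eF => x [c Fc cx]; have ltfc : f c < n := ffun _ Fc.
  exists (Ordinal ltfc) => //; rewrite JidealE.
  have [Fg fg] := gP (Ordinal ltfc).
  suff -> : g (Ordinal ltfc) = c by [].
  by apply: finj; rewrite ?inE.
by move=> i chii; exists (g i) => //; have [] := gP i.
Qed.

Lemma same_germ_finitely_aligned (p q : germ_pair C) : finitely_aligned C ->
  same_germ (@Jbar_one C) p q -> same_germ (@J_one C) p q.
Proof.
move=> fa [pq [_ [e [n [f [_ -> ce cf]]]] pqeps]].
pose d := Jmeet e (Ildom (pair_elt p)).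
have [F Ffin dF] := J_finitely_generated d fa.
have cd : pair_chi p d by rewrite OmegaM ce pairP.
have [c Fc chic] := Omega_finitely_generated Ffin dF cd.
have [ec pc] : (d : set C) c.
  by rewrite dF; exists c => //; exact: right_ideal_refl.
apply: (same_germ_at_point pq pqeps _ pc chic); split => // -[i _ fic].
have := cf i; rewrite (Omega_le _ chic)// JidealE.
exact: J_right_ideal.
Qed.

End FinitelyAligned.

(** * Density of point characters *)

Section PointCharacters.
Variable C : lcCategory.

Lemma point_char_subproof (x : C) :
  Omega_set (fun e : J C => `[< (e : set C) x >]).
Proof.
split; first split.
- by exists (Jideal x); apply/asboolP; rewrite JidealE; exact: right_ideal_refl.
- by move=> e f; rewrite -asbool_and.
- by move=> e ->; apply/asboolP.
- move=> e n f -> /asboolP[i _ fix_].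
  by exists i; apply/asboolP.
Qed.

Definition point_char (x : C) : Omega C := SigSub (mem_set (point_char_subproof x)).

Lemma point_charP (x : C) (e : J C) : point_char x e <-> (e : set C) x.
Proof. by split => /asboolP. Qed.

Lemma point_char_Jbar_one (x : C) (eps : set C) :
  Jbar_one (point_char x) eps -> eps x.
Proof.
move=> [e [n [f [_ -> /point_charP ex nfx]]]]; split => // -[i _ fix_].
by have /negP := nfx i; apply; apply/point_charP.
Qed.

Lemma Jbar_one_neq0 (chi : Omega C) (eps : set C) :
  Jbar_one chi eps -> eps !=set0.
Proof.
move=> [e [n [f [_ -> ce cf]]]]; apply/set0P/negP => /eqP/disjoints_subset.
rewrite setCK => ef.
by have [i] := Omega_cover ef ce; apply/negP.
Qed.

(** Point characters converge to [chi] along the sets charged by [chi], which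
    form a filter base on C. *)
Lemma point_char_dense (chi : Omega C) (U : set (Omega C)) :
  open U -> U chi -> exists x, U (point_char x).
Proof.
move=> oU Uchi.
pose F : set_system C := filter_from (Jbar_one chi) id.
have FF : Filter F.
  apply: filter_from_filter.
    have [e ce] := OmegaN0 chi.
    by exists e; exact: gb_J (Jbar_one_base C) _ _ ce.
  by move=> a b ca cb; exists (a `&` b) => //; exact: gb_I (Jbar_one_base C) _ _ _ ca cb.
have PF : ProperFilter F by apply: filter_from_proper => a; exact: Jbar_one_neq0.
have near_eval (e : J C) : F [set x | point_char x e = chi e].
  case ce : (chi e).
    exists (e : set C); first exact: gb_J (Jbar_one_base C) _ _ ce.
    by move=> x /point_charP.
  have [g cg] := OmegaN0 chi.
  exists ((g : set C) `\` \bigcup_(i in [set: 'I_1]) (Jmeet e g : set C)).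
    exists g, 1, (fun=> Jmeet e g); split => //; first by move=> _ x [].
    by move=> _; rewrite OmegaM ce.
  move=> x [gx negx]; apply/negbTE/negP => /point_charP ex.
  by apply: negx; exists ord0.
case: oU => V oV VU.
have : F [set x | V (Ochar (point_char x))].
  suff : (fun x => Ochar (point_char x) : {ptws J C -> bool}) @ F -->
      (Ochar chi : {ptws J C -> bool}).
    by apply; apply: open_nbhs_nbhs; split => //; move: Uchi; rewrite -VU set_valE.
  apply/cvg_sup => e B [V' [[W oW <-] We] V'B].
  apply: filterS (near_eval e) => x /= xe; apply: V'B.
  by rewrite /preimage/= /proj xe.
by move=> /filter_ex[x Vx]; exists x; rewrite -VU set_valE.
Qed.

Lemma same_germ_hausdorff (p q : germ_pair C) :
  hausdorff_space (transformation_groupoid C) ->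
  same_germ (@Jbar_one C) p q -> same_germ (@J_one C) p q.
Proof.
rewrite open_hausdorff => T2 [pq [eps chieps pqeps]].
apply/(germ_piP (J_one_base C)); apply: contrapT => /eqP/T2 [[A B] /=].
rewrite !inE => -[Ap Bq] [/germ_openP/(_ (pair_elt p)) oA].
move=> /germ_openP/(_ (pair_elt q)) oB AB0.
have [||x [[[px Ax] [qx Bx]] epsx]] := @point_char_dense (pair_chi p) (
    [set psi : Omega C | exists h : psi (Ildom (pair_elt p)),
       A (germ_of (J_one_base C) h)] `&`
    [set psi : Omega C | exists h : psi (Ildom (pair_elt q)),
       B (germ_of (J_one_base C) h)] `&`
    [set psi | Jbar_one psi eps]).
- by apply: openI; [exact: openI | exact: gb_open (Jbar_one_base C) eps].
- split => //; split.
    by exists (pairP p); rewrite /germ_of pairE.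
  rewrite /= pq; exists (pairP q).
  by rewrite /germ_of pairE.
suff pqx : germ_of (J_one_base C) px = germ_of (J_one_base C) qx.
  by have : (A `&` B) (germ_of (J_one_base C) px); [split => //; rewrite pqx | rewrite AB0].
apply/germ_piP; apply: (same_germ_at_point (eps := eps) (x := x)) => //.
- exact: point_char_Jbar_one.
- by have /point_charP := px.
- suff : point_char x (Jideal x) by [].
  by apply/point_charP; rewrite JidealE; exact: right_ideal_refl.
Qed.

End PointCharacters.

(** * Comparison of groupoids of germs *)

(** Nothing but an inclusion of germ relations is assumed, so that the
    projection and its inverse are two instances of the same construction. *)
Section ChangeBase.
Variables (C : lcCategory) (E E' : Omega C -> set (set C)).
Variables (hE : germ_base E) (hE' : germ_base E').

Definition change_base (g : germ_groupoid hE) : germ_groupoid hE' :=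
  germ_pi hE' (germ_repr g).

Hypothesis EE' : forall p q, same_germ E p q -> same_germ E' p q.

Lemma change_base_pi p : change_base (germ_pi hE p) = germ_pi hE' p.
Proof. by apply/germ_piP/EE'; exact: germ_repr_pi. Qed.

Lemma change_base_morphism : groupoid_morphism change_base.
Proof.
apply: (germ_mulP (P := fun g h gh => germ_src (change_base g : germ hE') =
    germ_rng (change_base h : germ hE') /\ change_base gh =
    germ_mul (change_base g : germ hE') (change_base h : germ hE'))).
move=> s t chi ht hs hst; rewrite /germ_of !change_base_pi -!/(germ_of _ _).
by rewrite germ_srcE germ_rngE (germ_mulE hE' hs hst).
Qed.

Lemma change_base_continuous : continuous change_base.
Proof.
apply/continuousP => W /germ_openP oW; apply/germ_openP => s.
have := oW s; congr open; apply/seteqP; split=> chi /= [h Wh]; exists h;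
  by move: Wh; rewrite /germ_of change_base_pi.
Qed.

End ChangeBase.

Arguments change_base {C E E'} hE hE' g.

Lemma change_baseK (C : lcCategory) (E E' : Omega C -> set (set C))
    (hE : germ_base E) (hE' : germ_base E') :
  (forall p q, same_germ E' p q -> same_germ E p q) ->
  cancel (change_base hE hE') (change_base hE' hE).
Proof.
move=> E'E g.
by rewrite [change_base hE _ g]/change_base change_base_pi ?germ_reprK.
Qed.

Unset Implicit Arguments.
Set Strict Implicit.

Theorem lemma3p2 (C : lcCategory) :
  finitely_aligned C \/ hausdorff_space (transformation_groupoid C) ->
  topGroupoid_isomorphism (@canonical_projection C).
Proof.
move=> hC.
have barJ p q : same_germ (@Jbar_one C) p q -> same_germ (@J_one C) p q.
  case: hC => [fa|T2]; first exact: same_germ_finitely_aligned.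
  exact: same_germ_hausdorff.
have Jbar p q : same_germ (@J_one C) p q -> same_germ (@Jbar_one C) p q.
  by move=> [pq [a /J_one_Jbar_one ? ?]]; split => //; exists a.
have -> : @canonical_projection C =
  change_base (J_one_base C) (Jbar_one_base C) by [].
split; [exact: change_base_morphism | split; first exact: change_base_continuous].
exists (change_base (Jbar_one_base C) (J_one_base C)); split.
- exact: change_baseK.
- exact: change_baseK.
- exact: change_base_morphism.
- exact: change_base_continuous.
Qed.
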